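(* Let $(\bar{M}, g)$ be a compact Riemannian manifold with smooth boundary $\partial M$ and interior $M$, with $n = \dim \bar{M} \geqslant 3$. Suppose that the scalar curvature satisfies $S_{g} \leqslant 0$ everywhere. Then there exists a metric $\tilde{g}$ conformal to $g$, with scalar curvature $\tilde{S}$ and mean curvature $\tilde{h}$ on $\partial M$, such that $\tilde{S} > 0$ somewhere, and $\operatorname{sgn}(h_{g}) = \operatorname{sgn}(\tilde{h})$ pointwise on $\partial M$.
   Context: A metric conformal to $g$ is a metric of the form $\tilde{g} = u^{p-2} g$ with $p = \frac{2n}{n-2}$ and $u \in C^{\infty}(\bar{M})$, $u > 0$ on $\bar{M}$. $S_{g}$ is the scalar curvature of $g$ and $h_{g}$ the mean curvature of $\partial M$ with respect to $g$, taken with respect to the outward unit normal $\nu$, with sign and normalization such that under $\tilde{g} = e^{2f} g$ it transforms as $\tilde{h} = e^{-f}\left(h_{g} + \frac{\partial f}{\partial \nu}\right)$ (the average of the principal curvatures, positive for the Euclidean ball). $\operatorname{sgn}$ takes values in $\{-1, 0, 1\}$. *)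

(* Defs.v *)
From HB Require Import structures.
From mathcomp Require Import all_boot all_order all_algebra.
From mathcomp Require Import all_classical all_reals all_analysis.
Set Implicit Arguments.
Unset Strict Implicit.
Unset Printing Implicit Defensive.
Import Order.TTheory GRing.Theory Num.Theory.
Import numFieldNormedType.Exports.
Local Open Scope classical_set_scope.
Local Open Scope ring_scope.

(* Row vectors carry the sup norm, which induces the usual topology. *)
Section smooth_functions.
Variables (R : realType) (n : nat).
Implicit Types (A U : set 'rV[R]_n) (f : 'rV[R]_n -> R).

Fixpoint is_Ck (k : nat) U f : Prop :=
  match k with
  | 0 => forall x, U x -> {for x, continuous f}
  | k'.+1 => (forall x, U x -> differentiable f x) /\
             (forall i : 'I_n, is_Ck k' U (fun x => 'D_(delta_mx 0 i) f x))
  end.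

Definition is_Cinfty U f : Prop := forall k, is_Ck k U f.

(* Smoothness on an arbitrary set: local existence of smooth extensions to
   open subsets of R^n. *)
Definition smooth_on A f : Prop :=
  forall x, A x -> exists U (F : 'rV[R]_n -> R),
    [/\ open U, U x, is_Cinfty U F & forall y, U y -> A y -> F y = f y].

(* i-th partial derivative at x, along increments that stay in A. On a
   relatively open subset A of the half-space it is one-sided at the points of
   the wall in the direction transverse to it, and it is the usual partial
   derivative otherwise. *)
Definition partial_in A (i : 'I_n) f (x : 'rV[R]_n) : R :=
  lim ((fun t : R => t^-1 * (f (x + t *: delta_mx 0 i) - f x))
         @ within [set t : R | A (x + t *: delta_mx 0 i)] (0 : R)^').

End smooth_functions.

Definition half_space (R : realType) (n : nat) : set 'rV[R]_n.+1 :=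
  [set x | 0 <= x 0 ord0].

(* Smooth manifolds with (possibly empty) boundary, of dimension n.+1. The
   atlas is indexed by chart_idx; the values of [chart c] outside of [dom c]
   and of [param c] outside of [img c] are irrelevant. *)
Record manifold (R : realType) (n : nat) := Manifold {
  carrier :> topologicalType ;
  carrier_hausdorff : hausdorff_space carrier ;
  carrier_second_countable : @second_countable carrier ;
  chart_idx : Type ;
  dom : chart_idx -> set carrier ;
  img : chart_idx -> set 'rV[R]_n.+1 ;
  chart : chart_idx -> carrier -> 'rV[R]_n.+1 ;
  param : chart_idx -> 'rV[R]_n.+1 -> carrier ;
  dom_open : forall c, open (dom c) ;
  img_open : forall c, exists2 O : set 'rV[R]_n.+1,
    open O & img c = O `&` @half_space R n ;
  chart_img : forall c p, dom c p -> img c (chart c p) ;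
  param_dom : forall c x, img c x -> dom c (param c x) ;
  chartK : forall c p, dom c p -> param c (chart c p) = p ;
  paramK : forall c x, img c x -> chart c (param c x) = x ;
  chart_continuous : forall c, {within dom c, continuous (chart c)} ;
  param_continuous : forall c, {within img c, continuous (param c)} ;
  chart_at : carrier -> chart_idx ;
  dom_chart_at : forall p, dom (chart_at p) p ;
  transition_smooth : forall (c d : chart_idx) (j : 'I_n.+1),
    smooth_on (chart c @` (dom c `&` dom d))
              (fun x => chart d (param c x) 0 j)
}.

Section manifolds.
Variables (R : realType) (n : nat) (M : manifold R n).
Implicit Types (c : chart_idx M) (p : M) (u f : M -> R) (i j k l : 'I_n.+1).

Definition smooth u : Prop :=
  forall c, smooth_on (img c) (fun x => u (param c x)).

Definition boundary : set M :=
  [set p | exists2 c, dom c p & chart c p 0 ord0 = 0].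

(* (∂f/∂x^i)(p) in the chart c, for p in [dom c] *)
Definition pderiv c i f p : R :=
  partial_in (img c) i (fun x => f (param c x)) (chart c p).

Definition transition_jacobian c d p : 'M[R]_n.+1 :=
  \matrix_(i, j) pderiv c i (fun q => chart d q 0 j) p.

End manifolds.
Arguments boundary {R n} M.

(* [metric c p] is the Gram matrix at p, for p in [dom c], of the coordinate
   vector fields of the chart c. *)
Record riemannian_metric (R : realType) (n : nat) (M : manifold R n) :=
  RiemannianMetric {
  metric :> chart_idx M -> M -> 'M[R]_n.+1 ;
  metric_smooth : forall c (i j : 'I_n.+1),
    smooth_on (img c) (fun x => metric c (param c x) i j) ;
  metric_sym : forall c p, dom c p -> (metric c p)^T = metric c p ;
  metric_posdef : forall c p (v : 'rV[R]_n.+1), dom c p -> v != 0 ->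
    0 < (v *m metric c p *m v^T) 0 0 ;
  metric_transition : forall c d p, dom c p -> dom d p ->
    metric c p = transition_jacobian c d p *m metric d p
                   *m (transition_jacobian c d p)^T
}.

Section curvature.
Variables (R : realType) (n : nat) (M : manifold R n).
Variable g : riemannian_metric M.
Implicit Types (c : chart_idx M) (p : M) (i j k l m : 'I_n.+1).

(* Γ^k_ij *)
Definition christoffel c k i j p : R :=
  2^-1 * \sum_l invmx (g c p) k l *
    (pderiv c i (fun q => g c q j l) p + pderiv c j (fun q => g c q i l) p
     - pderiv c l (fun q => g c q i j) p).

(* R_ijk^l = dx^l(R(∂_i, ∂_j) ∂_k), where
   R(X, Y) = ∇_X ∇_Y - ∇_Y ∇_X - ∇_[X, Y] *)
Definition riemann c i j k l p : R :=
  pderiv c i (christoffel c l j k) p - pderiv c j (christoffel c l i k) p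
  + \sum_m (christoffel c m j k p * christoffel c l i m p
            - christoffel c m i k p * christoffel c l j m p).

(* Ric(Y, Z) = tr (X |-> R(X, Y) Z), positive on round spheres *)
Definition ricci c j k p : R := \sum_i riemann c i j k i p.

Definition scalar_curvature_in c p : R :=
  \sum_j \sum_k invmx (g c p) j k * ricci c j k p.

(* The value does not depend on the chart around p. *)
Definition scalar_curvature p : R := scalar_curvature_in (chart_at p) p.

(* k-th component of - grad x^0 / |grad x^0|, which on the wall x^0 = 0 is the
   outward unit normal, as the chart takes its values in x^0 >= 0 *)
Definition outward_normal c k p : R :=
  - invmx (g c p) k ord0 / Num.sqrt (invmx (g c p) ord0 ord0).

(* k-th component of ∇_∂i ν *)
Definition nabla_normal c i k p : R :=
  pderiv c i (outward_normal c k) p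
  + \sum_j christoffel c k i j p * outward_normal c j p.

(* <∇_∂i ν, ∂_j>, positive definite on the boundary of a Euclidean ball *)
Definition second_fundamental_form c i j p : R :=
  \sum_k nabla_normal c i k p * g c p k j.

(* The vectors ∂_(lift ord0 a), for a : 'I_n, span the tangent space of the
   boundary. *)
Definition boundary_metric c p : 'M[R]_n :=
  \matrix_(a, b) g c p (lift ord0 a) (lift ord0 b).

Definition mean_curvature_in c p : R :=
  n%:R^-1 * \sum_(a < n) \sum_(b < n) invmx (boundary_metric c p) a b *
    second_fundamental_form c (lift ord0 a) (lift ord0 b) p.

(* Meaningful for p in [boundary M]. Smooth transition maps preserve the wall,
   so that [chart_at p] maps such a p to the wall, and the value does not
   depend on the chart around p. *)
Definition mean_curvature p : R := mean_curvature_in (chart_at p) p.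

End curvature.

Definition critical_exponent (R : realType) (n : nat) : R :=
  2 * n%:R / (n%:R - 2).

Definition conformal (R : realType) (n : nat) (M : manifold R n)
    (g g' : riemannian_metric M) : Prop :=
  exists u : M -> R,
    [/\ smooth u, (forall p, 0 < u p) &
        forall c p, dom c p ->
          g' c p = (u p `^ (critical_exponent R n.+1 - 2)) *: g c p].

(* Main.v *)
(* For g' = e^phi g on a manifold of dimension n + 1, at a critical point p of
   phi,  S'(p) = e^(-phi(p)) (S(p) - n g^ij ∂_i ∂_j phi(p)).
   Take for phi a large multiple of a bump function supported in the interior
   of a chart, whose Hessian at its maximum p is a negative multiple of the
   identity in that chart. Then S'(p) > 0. Moreover g' = g near the boundary,
   since an interior point of one chart is interior in every chart, so the mean
   curvature does not change at all. *)
Require Import Defs.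
From HB Require Import structures.
From mathcomp Require Import all_boot all_order all_algebra.
From mathcomp Require Import all_classical all_reals all_analysis.
From mathcomp Require Import ring.
Set Implicit Arguments.
Unset Strict Implicit.
Unset Printing Implicit Defensive.
Import Order.TTheory GRing.Theory Num.Theory.
Import numFieldNormedType.Exports.
Local Open Scope classical_set_scope.
Local Open Scope ring_scope.

(** * Functions of class C^k *)

(** In the interior of a chart the limits of [partial_in] become ordinary derivatives, and
    smoothness by local extension becomes [is_Cinfty]; the whole computation of S' takes place
    there. The general conformal law for the scalar curvature is avoided: the correction to the
    Christoffel symbols is linear in the first derivatives of phi, so at a critical point the
    symbols agree and only their derivatives change, by Hessian terms. Contracting a Hessian eta *
    Id leaves - n eta tr(g^-1), and tr(g^-1) > 0. With phi = tau * psi, the number tau is solved for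
    so that S' = e^(-phi) at the centre of the bump. The delicate point is global: the bump is a
    formula in one chart, and its extension by zero is smooth in all the others because the image of
    a compact cube is closed in a Hausdorff space. *)

Section is_derive_pointwise.
Variables (R : realType) (V : normedModType R).
Implicit Types (f g : V -> R) (x v : V).

Lemma is_derive_addf f g x v df dg : is_derive x v f df ->
  is_derive x v g dg -> is_derive x v (fun y => f y + g y) (df + dg).
Proof. exact: is_deriveD. Qed.

Lemma is_derive_mulf f g x v df dg : is_derive x v f df ->
  is_derive x v g dg ->
  is_derive x v (fun y => f y * g y) (df * g x + f x * dg).
Proof.
move=> hf hg; have := is_deriveM hf hg; rewrite addrC.
by rewrite (mulrC df).
Qed.

Lemma is_derive_sumf m (f : 'I_m -> V -> R) x v df :
  (forall i, is_derive x v (f i) (df i)) ->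
  is_derive x v (fun y => \sum_(i < m) f i y) (\sum_(i < m) df i).
Proof.
move=> h; have := is_derive_sum h.
by rewrite (_ : \sum_(i < m) f i = fun y => \sum_(i < m) f i y)//;
  apply/funext => y; rewrite fct_sumE.
Qed.

Lemma is_derive_scalef (c : R) f x v df : is_derive x v f df ->
  is_derive x v (fun y => c * f y) (c * df).
Proof. by move=> h; exact: (is_deriveZ c h). Qed.

Lemma differentiable_is_derive f x v :
  differentiable f x -> is_derive x v f ('D_v f x).
Proof. by move=> df; apply: derivableP; exact: diff_derivable. Qed.

Lemma differentiable_comp1 (h : R -> R) f x (dh : R) :
  is_derive (f x) 1 h dh -> differentiable f x ->
  differentiable (fun y => h (f y)) x.
Proof.
move=> [hd _] fd; apply: (@differentiable_comp _ _ _ _ f h) => //.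
exact/derivable1_diffP.
Qed.

Lemma derive_comp1 (h : R -> R) f x v (dh : R) :
  is_derive (f x) 1 h dh -> differentiable f x ->
  'D_v (fun y => h (f y)) x = dh * 'D_v f x.
Proof.
move=> [hd hE] fd; have hd' : differentiable h (f x) by exact/derivable1_diffP.
rewrite deriveE; last exact: (@differentiable_comp _ _ _ _ f h).
rewrite (diff_comp fd hd') /= diff1E// derive1E hE deriveE//.
by rewrite mulrC.
Qed.

Lemma differentiable_sumf (I : Type) (s : seq I) (f : I -> V -> R) x :
  (forall i, differentiable (f i) x) ->
  differentiable (fun y => \sum_(i <- s) f i y) x.
Proof.
move=> fd; elim: s => [|i s IH].
  by under eq_fun do rewrite big_nil; exact: differentiable_cst.
by under eq_fun do rewrite big_cons; exact: differentiableD.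
Qed.

Lemma cvg_line x v :
  (fun t : R => x + t *: v) @ 0 --> x.
Proof.
rewrite -[X in _ --> X]addr0; apply: cvgD; first exact: cvg_cst.
by rewrite -[X in _ --> X](scale0r v); apply: cvgZr_tmp; exact: cvg_id.
Qed.

(** Fermat's rule on the line through x: the difference quotients are non-positive from the left and
    non-negative from the right. *)
Lemma derive_min_eq0 (h : V -> R) x v :
  differentiable h x -> (\forall y \near x, h x <= h y) -> 'D_v h x = 0.
Proof.
move=> hd hmin.
have [+ _] := derivable1P h x v; move=> /(_ (diff_derivable (v := v) hd)).
set k := fun t : R => h (t *: v + x) => kd.
have kmin : \forall t \near (0 : R), k 0 <= k t.
  have hm : \forall t \near (0 : R), h x <= h (x + t *: v).
    exact: cvg_line hmin.
  by apply: filterS hm => t; rewrite /k scale0r add0r addrC.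
have -> : 'D_v h x = 'D_1 k 0.
  rewrite /derive; set k1 := (X in lim (X @ _)).
  set k2 := (X in _ = lim (X @ _)); suff -> : k1 = k2 by [].
  apply/funext => t; rewrite /k1 /k2 /= /k.
  by rewrite scale0r addr0 add0r [t *: 1]mulr1.
apply/eqP; rewrite eq_le; apply/andP; split.
  have kl := cvg_dnbhs_at_left kd; apply: (cvgr_to_le kl).
  near=> t; rewrite /= addr0 [t *: 1]mulr1.
  apply: mulr_le0_ge0; first by rewrite invr_le0 ltW.
  by rewrite subr_ge0; near: t; apply: cvg_within.
have kr := cvg_dnbhs_at_right kd; apply: (cvgr_to_ge kr).
near=> t; rewrite /= addr0 [t *: 1]mulr1.
apply: mulr_ge0; first by rewrite invr_ge0 ltW.
by rewrite subr_ge0; near: t; apply: cvg_within.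
Unshelve. all: by end_near. Qed.

(** The differential of f satisfies the little-o estimate for g as well, and [diff_unique] then
    identifies it with the differential of g. *)
Lemma near_eq_differentiable f g x :
  (\near x, f x = g x) -> differentiable f x -> differentiable g x.
Proof.
move=> fg df.
have dfc : continuous ('d f x) by exact: diff_continuous.
have dfE := diff_locally df.
have fgx : f x = g x := nbhs_singleton fg.
have dgE : g \o shift x = cst (g x) + 'd f x +o_ (0 : V) id.
  apply/eqaddoP => e e0.
  move/eqaddoP : dfE => /(_ e e0) dfE.
  have nfg : \forall y \near (0 : V), f (y + x) = g (y + x).
    have := fg; rewrite (near_shift 0) /=.
    by apply: filterS => y /=; rewrite subr0.
  near=> y.
  have nE : f (y + x) = g (y + x) by near: y.
  have dfy : `|(f \o shift x - (cst (f x) + 'd f x)) y| <= e * `|y|.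
    by near: y; exact: dfE.
  by move: dfy; rewrite !fctE /= nE fgx.
have dE := diff_unique dfc dgE.
by apply/diff_locallyP; rewrite dE; split.
Unshelve. all: by end_near. Qed.

End is_derive_pointwise.

Section is_Ck_closure.
Variables (R : realType) (n : nat).
Implicit Types (U A : set 'rV[R]_n) (f g : 'rV[R]_n -> R).

(** Continuity and differentiability at x refer to full neighbourhoods of x; since U is open,
    equality on U is equality of germs. *)
Lemma is_Ck_eq k U f g : open U -> (forall x, U x -> f x = g x) ->
  is_Ck k U f -> is_Ck k U g.
Proof.
move=> Uo; elim: k f g => [|k IH] f g fg /=;
  (have nfg x : U x -> {near nbhs x, f =1 g}
    by move=> Ux; apply: filterS (open_nbhs_nbhs (conj Uo Ux)) => y; exact: fg).
  move=> fc x Ux; rewrite /prop_for /continuous_at -(fg _ Ux).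
  by apply: cvg_trans (fc x Ux); exact: near_eq_cvg (nfg x Ux).
move=> [fd fD]; split=> [x Ux|i].
  exact: near_eq_differentiable (nfg x Ux) (fd x Ux).
apply: IH (fD i) => x Ux; exact: near_eq_derive (nfg x Ux).
Qed.

Lemma is_Ck_subset k U A f : A `<=` U -> is_Ck k U f -> is_Ck k A f.
Proof.
move=> AU; elim: k f => [|k IH] f /=; first by move=> h x /AU; exact: h.
by move=> [fd fD]; split=> [x /AU|i]; [exact: fd|exact: IH].
Qed.

(** At every order [is_Ck] is a condition on germs in the ambient space, point by point, so it can
    be checked on pieces. *)
Lemma is_Ck_local k A f :
  (forall x, A x -> exists2 U, U x & is_Ck k (U `&` A) f) -> is_Ck k A f.
Proof.
elim: k f => [|k IH] f /= h; first by move=> x Ax; have [U Ux] := h x Ax; exact.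
split=> [x Ax|i]; first by have [U Ux [+ _]] := h x Ax; exact.
by apply: IH => x Ax; have [U Ux [_ hU]] := h x Ax; exists U.
Qed.

Lemma is_CkW k U f : is_Ck k.+1 U f -> is_Ck k U f.
Proof.
elim: k f => [|k IH] f /= [fd fD].
  by move=> x Ux; apply: differentiable_continuous; exact: fd.
by split=> // i; exact: (IH _ (fD i)).
Qed.

Lemma is_Ck_cst k U c : is_Ck k U (cst c).
Proof.
elim: k c => [|k IH] c /=; first by move=> x _; exact: cst_continuous.
split=> // i.
by rewrite (_ : (fun _ => _) = cst 0)//; apply/funext => x; rewrite derive_cst.
Qed.

Lemma is_CkD k U f g : open U -> is_Ck k U f -> is_Ck k U g ->
  is_Ck k U (fun x => f x + g x).
Proof.
move=> Uo; elim: k f g => [|k IH] f g /=.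
  by move=> fc gc x Ux; exact: (continuousD (fc x Ux) (gc x Ux)).
move=> [fd fD] [gd gD]; split=> [x Ux|i].
  by apply: differentiableD; [exact: fd|exact: gd].
apply: is_Ck_eq (IH _ _ (fD i) (gD i)) => // x Ux.
by rewrite deriveD//; apply: diff_derivable; [exact: fd|exact: gd].
Qed.

Lemma is_CkM k U f g : open U -> is_Ck k U f -> is_Ck k U g ->
  is_Ck k U (fun x => f x * g x).
Proof.
move=> Uo; elim: k f g => [|k IH] f g.
  by move=> fc gc x Ux; exact: (continuousM (fc x Ux) (gc x Ux)).
move=> fC gC; have [fd fD] := fC; have [gd gD] := gC; split=> [x Ux|i].
  by apply: differentiableM; [exact: fd|exact: gd].
have := is_CkD Uo (IH _ _ (fD i) (is_CkW gC)) (IH _ _ (is_CkW fC) (gD i)).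
apply: is_Ck_eq => // x Ux; apply/esym.
have df := differentiable_is_derive (delta_mx 0 i) (fd x Ux).
have dg := differentiable_is_derive (delta_mx 0 i) (gd x Ux).
by have [_ ->] := is_derive_mulf df dg.
Qed.

Lemma derive_coord (i j : 'I_n) (x : 'rV[R]_n) :
  is_derive x (delta_mx 0 i) (fun y : 'rV[R]_n => y 0 j) (i == j)%:R.
Proof.
apply: DeriveDef; first by apply: diff_derivable; exact: differentiable_coord.
rewrite /derive; apply: (@cvg_lim _ (@Rhausdorff R)).
apply: cvg_trans (@cvg_cst _ ((i == j)%:R : R) _ (0 : R)^' _).
apply: near_eq_cvg; near=> t => /=.
have t0 : t != 0 by near: t; exact: nbhs_dnbhs_neq.
by rewrite !mxE addrK eqxx /= eq_sym scalerA mulVf// scale1r.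
Unshelve. all: by end_near. Qed.

(* Covers both [expR] and the functions t^-m exp(-1/t), whose derivatives are
   combinations of two functions of the same kind. *)
Lemma is_Ck_comp1 k U (h : nat -> R -> R) (a b : nat -> R) q m : open U ->
  (forall m (t : R),
    is_derive t (1 : R) (h m) (a m * h m.+1 t + b m * h m.+2 t)) ->
  is_Ck k U q -> is_Ck k U (fun x => h m (q x)).
Proof.
move=> Uo hd; elim: k m q => [|k IH] m q.
  move=> qc x Ux; apply: (@continuous_comp _ _ _ q (h m)); first exact: qc.
  apply: differentiable_continuous; apply/derivable1_diffP.
  by have [] := hd m (q x).
move=> qC; have [qd qD] := qC; split=> [x Ux|i].
  by apply: differentiable_comp1 (hd m (q x)) _; exact: qd.
have hC c l : is_Ck k U (fun x => c * h l (q x)).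
  exact: is_CkM Uo (is_Ck_cst _ _ c) (IH l _ (is_CkW qC)).
have := is_CkM Uo (is_CkD Uo (hC (a m) m.+1) (hC (b m) m.+2)) (qD i).
apply: is_Ck_eq => // x Ux.
by rewrite (derive_comp1 _ (hd m (q x)) (qd x Ux)).
Qed.

End is_Ck_closure.

Section smooth_on_closure.
Variables (R : realType) (n : nat).
Implicit Types (U A B : set 'rV[R]_n) (f g : 'rV[R]_n -> R).

Lemma smooth_on_eq A f g : (forall x, A x -> f x = g x) ->
  smooth_on A f -> smooth_on A g.
Proof.
move=> fg fA x Ax; have [U [F [Uo Ux FC FE]]] := fA x Ax.
by exists U, F; split=> // y Uy Ay; rewrite FE// fg.
Qed.

Lemma smooth_on_subset A B f : B `<=` A -> smooth_on A f -> smooth_on B f.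
Proof.
move=> BA fA x /BA Ax; have [U [F [Uo Ux FC FE]]] := fA x Ax.
by exists U, F; split=> // y Uy /BA; exact: FE.
Qed.

Lemma smooth_on_local A f :
  (forall x, A x -> exists W, [/\ open W, W x & smooth_on (A `&` W) f]) ->
  smooth_on A f.
Proof.
move=> h x Ax; have [W [Wo Wx fW]] := h x Ax.
have [U [F [Uo Ux FC FE]]] := fW x (conj Ax Wx).
exists (U `&` W), F; split=> //; first exact: openI.
  by move=> k; apply: is_Ck_subset (FC k) => y [].
by move=> y [Uy Wy] Ay; exact: FE.
Qed.

Lemma smooth_on_cst A c : smooth_on A (cst c).
Proof.
by move=> x Ax; exists setT, (cst c); split=> //; [exact: openT|];
  move=> k; exact: is_Ck_cst.
Qed.

Lemma smooth_onD A f g : smooth_on A f -> smooth_on A g ->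
  smooth_on A (fun x => f x + g x).
Proof.
move=> fA gA x Ax; have [U [F [Uo Ux FC FE]]] := fA x Ax.
have [W [G [Wo Wx GC GE]]] := gA x Ax.
exists (U `&` W), (fun x => F x + G x); split=> //; first exact: openI.
  move=> k; apply: is_CkD; first exact: openI.
    by apply: is_Ck_subset (FC k) => y [].
  by apply: is_Ck_subset (GC k) => y [].
by move=> y [Uy Wy] Ay; rewrite FE// GE.
Qed.

Lemma smooth_onM A f g : smooth_on A f -> smooth_on A g ->
  smooth_on A (fun x => f x * g x).
Proof.
move=> fA gA x Ax; have [U [F [Uo Ux FC FE]]] := fA x Ax.
have [W [G [Wo Wx GC GE]]] := gA x Ax.
exists (U `&` W), (fun x => F x * G x); split=> //; first exact: openI.
  move=> k; apply: is_CkM; first exact: openI.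
    by apply: is_Ck_subset (FC k) => y [].
  by apply: is_Ck_subset (GC k) => y [].
by move=> y [Uy Wy] Ay; rewrite FE// GE.
Qed.

Lemma smooth_on_sum A m (f : 'I_m -> 'rV[R]_n -> R) :
  (forall i, smooth_on A (f i)) -> smooth_on A (fun x => \sum_(i < m) f i x).
Proof.
elim: m f => [|m IH] f fC.
  by apply: smooth_on_eq (smooth_on_cst 0) => x _; rewrite big_ord0.
have := smooth_onD (fC ord0) (IH (fun i => f (lift ord0 i)) (fun i => fC _)).
by apply: smooth_on_eq => // x _; rewrite big_ord_recl.
Qed.

Lemma smooth_on_comp1 A (h : nat -> R -> R) (a b : nat -> R) q m :
  (forall m (t : R),
    is_derive t (1 : R) (h m) (a m * h m.+1 t + b m * h m.+2 t)) ->
  smooth_on A q -> smooth_on A (fun x => h m (q x)).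
Proof.
move=> hd qA x Ax; have [U [F [Uo Ux FC FE]]] := qA x Ax.
exists U, (fun x => h m (F x)); split=> //.
  by move=> k; exact: is_Ck_comp1 hd (FC k).
by move=> y Uy Ay; rewrite FE.
Qed.

Lemma smooth_on_expR A q : smooth_on A q -> smooth_on A (fun x => expR (q x)).
Proof.
(* The constant family works: exp' = 1 * exp + 0 * exp. *)
apply: (@smooth_on_comp1 _ (fun=> expR) (fun=> 1) (fun=> 0) _ 0) => _ t.
by rewrite mul1r mul0r addr0; exact: is_derive_expR.
Qed.

(** Near a point of an open set the local extension is f itself. This turns the smoothness of
    metrics and transition maps into genuine iterated derivatives. *)
Lemma smooth_on_Cinfty A B f : open B -> B `<=` A -> smooth_on A f ->
  is_Cinfty B f.
Proof.
move=> Bo BA fA k; apply: is_Ck_local => x Bx.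
have [U [F [Uo Ux FC FE]]] := fA x (BA x Bx).
exists U => //; apply: (@is_Ck_eq _ _ _ _ F); first exact: openI.
  by move=> y [Uy /BA]; exact: FE.
by apply: is_Ck_subset (FC k) => y [].
Qed.

End smooth_on_closure.

(** * The flat function exp(-1/t) and its derivatives *)

Section flat_function.
Variable R : realType.
Implicit Types t : R.

Definition flat (m : nat) t : R :=
  if 0 < t then t^-1 ^+ m * expR (- t^-1) else 0.

Lemma flat_gt0 m t : 0 < t -> 0 < flat m t.
Proof.
by move=> t0; rewrite /flat t0 mulr_gt0// ?expR_gt0// exprn_gt0// invr_gt0.
Qed.

Lemma flat_le0 m t : t <= 0 -> flat m t = 0.
Proof. by rewrite /flat ltNge => ->. Qed.

(** With s = 1/t, the exponential series gives s^(m+2) / (m+2)! <= e^s, that is s^m e^(-s) <= (m+2)!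
    s^(-2). A quadratic bound is what a zero derivative at 0 requires. *)
Lemma flat_le_sqr m t : `|flat m t| <= m.+2`!%:R * t ^+ 2.
Proof.
have [t0|t0] := lerP t 0.
  by rewrite flat_le0// normr0 mulr_ge0// sqr_ge0.
rewrite ger0_norm ?(ltW (flat_gt0 _ t0))// /flat t0 expRN.
have s0 : 0 < t^-1 by rewrite invr_gt0.
have h : t^-1 ^+ m.+2 / m.+2`!%:R <= expR t^-1.
  by apply: le_trans (expR_ge1Dxn m.+1 (ltW s0)); rewrite lerDr.
have f0 : 0 < m.+2`!%:R :> R by rewrite ltr0n fact_gt0.
rewrite ler_pdivrMr ?expR_gt0//.
apply: le_trans (ler_wpM2l _ h); last by rewrite mulr_ge0// ?sqr_ge0// ltW.
rewrite le_eqVlt; apply/orP; left; apply/eqP.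
rewrite !exprS; field.
by rewrite !gt_eqF.
Qed.

Lemma is_derive_flat m t :
  is_derive t 1 (flat m) (- m%:R * flat m.+1 t + 1 * flat m.+2 t).
Proof.
have [t0|t0|->] := ltgtP t 0.
- rewrite !flat_le0 ?ltW// !mulr0 addr0.
  apply: near_eq_is_derive (is_derive_cst 0 t 1).
  near=> s; rewrite /= flat_le0// ltW//; near: s; exact: lt_nbhsl.
- rewrite /flat t0.
  pose F (s : R) : R := s^-1 ^+ m * expR (- s^-1).
  apply: (@near_eq_is_derive _ _ _ F).
    near=> s; rewrite /F ifT//; near: s; exact: lt_nbhsr.
  have tN0 : t != 0 by rewrite gt_eqF.
  have di : is_derive t (1 : R) (fun s : R => s^-1) (- t^-2).
    apply: is_derive_eq (is_deriveV tN0 (is_derive_id t 1)) _.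
    by rewrite [_ *: _]mulr1.
  have dn : is_derive t (1 : R) (fun s : R => - s^-1) (t^-2).
    by apply: is_derive_eq (is_deriveN di) _; rewrite opprK.
  have de : is_derive t (1 : R) (fun s : R => expR (- s^-1))
      (expR (- t^-1) * t^-2).
    exact: (@is_derive1_comp _ expR (fun s : R => - s^-1)).
  have dX : is_derive t (1 : R) (fun s : R => s^-1 ^+ m)
     (m%:R * t^-1 ^+ m.-1 * - t^-2).
    by have := is_deriveX m di; rewrite exprfctE.
  apply: is_derive_eq (is_derive_mulf dX de) _.
  (* The power rule produces [m.-1], so m = 0 is separate. *)
  rewrite -!exprVn; case: m {F dX} => [|m] /=; first by rewrite !expr2; ring.
  by rewrite !exprS; ring.
(* At 0 the difference quotient is at most (m+2)! |s| by [flat_le_sqr]. *)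
- rewrite !flat_le0// !mulr0 addr0.
  have f0 : 0 < m.+2`!%:R :> R by rewrite ltr0n fact_gt0.
  have c : (fun h : R => h^-1 *: (((flat m \o shift 0) (h *: 1)) - flat m 0))
      @ 0^' --> (0 : R).
    apply/cvgrPdist_le => e e0; near=> s.
    have s0 : s != 0 by near: s; exact: nbhs_dnbhs_neq.
    rewrite sub0r normrN /= addr0 [s *: 1]mulr1 (flat_le0 _ (lexx 0)) subr0.
    rewrite normrZ normfV ler_pdivrMl ?normr_gt0//.
    apply: le_trans (flat_le_sqr m s) _.
    rewrite -real_normK ?num_real// expr2 mulrCA ler_wpM2l// mulrC.
    rewrite -ler_pdivlMr//.
    near: s; apply: dnbhs0_le; exact: divr_gt0.
  by apply: DeriveDef; [apply/cvg_ex; exists 0|exact: cvg_lim c].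
Unshelve. all: by end_near. Qed.

End flat_function.

(** * Charts and conformal changes *)

Section manifold_charts.
Variables (R : realType) (n : nat) (M : manifold R n).
Implicit Types (c d : chart_idx M) (p q : M) (f : M -> R).

(** At a wall point [img c] is not a neighbourhood and [param c] is continuous only within it, hence
    the guard [img c y]. *)
Lemma near_param c (V : set M) p : dom c p -> nbhs p V ->
  \forall y \near chart c p, img c y -> V (param c y).
Proof.
move=> cp pV; have ix := chart_img cp.
have /subspace_continuousP/(_ _ ix) := param_continuous (c := c).
by rewrite /from_subspace chartK// => /(_ _ pV).
Qed.

Lemma img_half_space c x : img c x -> 0 <= x 0 ord0.
Proof. by have [W _ ->] := img_open c => -[]. Qed.

Lemma nbhs_img c x : img c x -> 0 < x 0 ord0 ->
  nbhs x (img c `&` [set y | 0 < y 0 ord0]).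
Proof.
have [W Wo ->] := img_open c => -[Wx _] x0.
have pos : nbhs x [set y : 'rV[R]_n.+1 | 0 < y 0 ord0].
  exact: (@coord_continuous R 1 n.+1 0 ord0 x _ (lt_nbhsr x0)).
apply: filterS (filterI (open_nbhs_nbhs (conj Wo Wx)) pos) => y [Wy y0].
by split=> //; split=> //; exact: ltW.
Qed.

(** The limit sees only points of the chart near p. This covers wall points too, where the
    derivative may be one-sided; the mean curvature needs that case. *)
Lemma pderiv_near c i f f' p : dom c p -> (\near p, f p = f' p) ->
  pderiv c i f p = pderiv c i f' p.
Proof.
move=> cp ff'; rewrite /pderiv /partial_in.
have ffp : f p = f' p := nbhs_singleton ff'.
have h := near_param cp ff'.
have line : \forall t \near (0 : R)^',
    img c (chart c p + t *: delta_mx 0 i) ->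
    f (param c (chart c p + t *: delta_mx 0 i)) =
    f' (param c (chart c p + t *: delta_mx 0 i)).
  apply: cvg_within.
  exact: cvg_line h.
congr (lim _); rewrite chartK// ffp eqEsubset; split; apply: near_eq_cvg;
  by apply: filterS line => t lineE /lineE /= ->.
Qed.

Lemma pderivE c i f p : nbhs (chart c p) (img c) ->
  pderiv c i f p = 'D_(delta_mx 0 i) (fun x => f (param c x)) (chart c p).
Proof.
move=> imgp; rewrite /pderiv /partial_in /derive.
have h : \forall t \near (0 : R)^', img c (chart c p + t *: delta_mx 0 i).
  apply: cvg_within; exact: cvg_line imgp.
(* The constraint to stay in [img c] holds for all small t, so it does not change the filter. *)
rewrite (_ : within _ _ = (0 : R)^'); last first.
  apply/funext => B; apply/propext; split=> [|hB].
    by rewrite /within /= => hB; apply: filterS2 h hB => t it; exact.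
  by rewrite /within /=; apply: filterS hB => t Bt _.
set k1 := (X in lim (X @ _)); set k2 := (X in _ = lim (X @ _)).
suff -> : k1 = k2 by [].
by apply/funext => t; rewrite /k1 /k2 /= /shift [X in param c X]addrC.
Qed.

End manifold_charts.

Section charts_interior.
Variables (R : realType) (n : nat) (M : manifold R n).
Variable g : riemannian_metric M.
Implicit Types (c d : chart_idx M) (p q : M).

Lemma metric_unitmx c p : dom c p -> g c p \in unitmx.
Proof.
move=> cp; rewrite unitmxE unitfE; apply/det0P => -[v v0 vg].
by have := metric_posdef g cp v0; rewrite vg mul0mx mxE ltxx.
Qed.

(* At a point of the wall for d that is not on the wall for c, the first
   coordinate of d would have a minimum that is interior for c, and the
   Jacobian would have a zero column. *)
Lemma chart_interior c d p : dom c p -> dom d p ->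
  0 < chart c p 0 ord0 -> 0 < chart d p 0 ord0.
Proof.
move=> cp dp cp0; rewrite lt_neqAle (img_half_space (chart_img dp)) andbT.
apply/eqP => dp0.
have imgx := nbhs_img (chart_img cp) cp0.
have imgx' : nbhs (chart c p) (img c) by apply: filterS imgx => y [].
have domx : nbhs (chart c p) [set y | img c y -> dom d (param c y)].
  apply: near_param => //; exact: open_nbhs_nbhs (conj (dom_open d) dp).
(* [W] is open in the full space, so the transition map is truly differentiable on it. *)
pose W := [set y | img c y /\ dom d (param c y)]°.
have Wx : W (chart c p) by apply: filterS2 imgx domx => y [iy _] /(_ iy).
have WE : W `<=` chart c @` (dom c `&` dom d).
  move=> y /interior_subset [iy dy]; exists (param c y); last exact: paramK.
  by split=> //; exact: param_dom.
have := smooth_on_Cinfty (@open_interior _ _) WE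
  (@transition_smooth _ _ M c d ord0).
move=> /(_ 1%N) [/(_ _ Wx) hd _].
have J0 i : transition_jacobian c d p i ord0 = 0.
  rewrite mxE pderivE//; apply: (derive_min_eq0 _ hd).
  apply: filterS (open_nbhs_nbhs (conj (@open_interior _ _) Wx)) => y.
  move=> /interior_subset[iy dy]; rewrite chartK// -dp0.
  exact: img_half_space (chart_img dy).
(* The Gram matrix for [c] is invertible and factors through the Jacobian, so the Jacobian is
   invertible; this replaces the chain rule for the inverse transition map. *)
have := metric_unitmx cp; rewrite (metric_transition g cp dp).
rewrite !unitmx_mul => /andP[/andP[+ _] _].
rewrite unitmxE (expand_det_col _ ord0) big1 ?unitr0// => i _.
by rewrite J0 mul0r.
Qed.

Lemma boundary_chart c p : dom c p -> boundary M p -> chart c p 0 ord0 = 0.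
Proof.
move=> cp [d dp dp0]; apply/eqP; rewrite eq_le (img_half_space (chart_img cp)).
rewrite andbT leNgt; apply/negP => cp0.
by have := chart_interior cp dp cp0; rewrite dp0 ltxx.
Qed.

(** A small step from any point in the inward direction [ord0] stays in the chart. The chart chosen
    at the new point may be another one, whence [chart_interior]. *)
Lemma exists_interior_point : [set: M] !=set0 ->
  exists p : M, 0 < chart (chart_at p) p 0 ord0.
Proof.
move=> [q _]; set c := chart_at q; set x := chart c q.
have ix : img c x := chart_img (dom_chart_at q).
have [W Wo imgE] := img_open c; have [Wx x0] : (W `&` half_space (n := n)) x.
  by rewrite -imgE.
have h : \forall t \near (0 : R)^'+, W (x + t *: delta_mx 0 ord0).
  apply: cvg_within; apply: cvg_line; exact: open_nbhs_nbhs.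
near (0 : R)^'+ => t.
have t0 : 0 < t by [].
have Wy : W (x + t *: delta_mx 0 ord0) by near: t; exact: h.
pose y := x + t *: delta_mx 0 ord0.
have y0 : 0 < y 0 ord0 by rewrite !mxE !eqxx mulr1 ltr_wpDl.
have iy : img c y by rewrite imgE; split; [exact: Wy|exact: ltW].
exists (param c y).
have := chart_interior (param_dom iy) (dom_chart_at (param c y)).
by rewrite paramK//; exact.
Unshelve. all: by end_near. Qed.

End charts_interior.

Section conformal_change.
Variables (R : realType) (n : nat) (M : manifold R n).
Variable g : riemannian_metric M.
Variables (phi : M -> R) (phi_smooth : smooth phi).

Let gphi (c : chart_idx M) p := expR (phi p) *: g c p.

Let gphi_smooth c (i j : 'I_n.+1) :
  smooth_on (img c) (fun x => gphi c (param c x) i j).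
Proof.
have := smooth_onM (smooth_on_expR (@phi_smooth c))
  (metric_smooth g (c := c) i j).
by apply: smooth_on_eq => x _; rewrite mxE.
Qed.

Let gphi_sym c p : dom c p -> (gphi c p)^T = gphi c p.
Proof. by move=> cp; rewrite /gphi linearZ /= Defs.metric_sym. Qed.

Let gphi_posdef c p (v : 'rV[R]_n.+1) : dom c p -> v != 0 ->
  0 < (v *m gphi c p *m v^T) 0 0.
Proof.
move=> cp v0; rewrite -scalemxAr -scalemxAl mxE mulr_gt0 ?expR_gt0//.
exact: metric_posdef.
Qed.

Let gphi_transition c d p : dom c p -> dom d p ->
  gphi c p = transition_jacobian c d p *m gphi d p
               *m (transition_jacobian c d p)^T.
Proof.
move=> cp dp; rewrite /gphi (metric_transition g cp dp).
by rewrite -!scalemxAr -scalemxAl.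
Qed.

(** Writing the factor as e^phi makes positivity automatic and the Christoffel correction linear in
    the derivatives of phi; the function u of [conformal] is recovered as an exponential at the
    end. *)
Definition conformal_metric : riemannian_metric M :=
  RiemannianMetric gphi_smooth gphi_sym gphi_posdef gphi_transition.

End conformal_change.

Section mean_curvature_germ.
Variables (R : realType) (n : nat) (M : manifold R n).
Variables g g' : riemannian_metric M.
Implicit Types (c : chart_idx M) (p : M).

Lemma near_christoffel c k i j p : dom c p -> (\near p, g c p = g' c p) ->
  christoffel g c k i j p = christoffel g' c k i j p.
Proof.
move=> cp gg'; rewrite /christoffel (nbhs_singleton gg').
congr (_ * _); apply: eq_bigr => l _; congr (_ * (_ + _ - _));
  by apply: pderiv_near => //; apply: filterS gg' => q ->.
Qed.

Lemma near_mean_curvature p : (forall c, \near p, g c p = g' c p) ->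
  mean_curvature g p = mean_curvature g' p.
Proof.
move=> /(_ (chart_at p)) gg'; rewrite /mean_curvature /mean_curvature_in.
have cp := dom_chart_at p; move: (chart_at p) cp gg' => c cp gg'.
have gp := nbhs_singleton gg'.
have nE k q : g c q = g' c q ->
    outward_normal g c k q = outward_normal g' c k q.
  by rewrite /outward_normal => ->.
rewrite /boundary_metric /second_fundamental_form /nabla_normal gp.
congr (_ * _); apply: eq_bigr => a _; apply: eq_bigr => b _; congr (_ * _).
apply: eq_bigr => k _; congr ((_ + _) * _).
  by apply: pderiv_near => //; apply: filterS gg' => q; exact: nE.
by apply: eq_bigr => j _; rewrite (near_christoffel _ _ _ cp gg') (nE _ _ gp).
Qed.

End mean_curvature_germ.

(** * Bump functions *)

Section bump_function.
Variables (R : realType) (n : nat).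
Implicit Types (a z : 'rV[R]_n) (r : R).

(** A closed cube is a product of segments, hence compact, and it fits the sup-norm topology. *)
Definition box a r : set 'rV[R]_n := [set z | forall j, `|z 0 j - a 0 j| <= r].

Lemma box_compact a r : compact (box a r).
Proof.
have := @rV_compact _ n (fun j => `[a 0 j - r, a 0 j + r]%classic).
rewrite (_ : mkset _ = box a r); first by apply=> j; exact: segment_compact.
apply/funext => z; apply/propext; rewrite /box /=.
by split=> h j; have := h j; rewrite /= in_itv /= distrC ler_distlC.
Qed.

Lemma nbhs_box a (A : set 'rV[R]_n) : nbhs a A ->
  exists2 r, 0 < r & box a r `<=` A.
Proof.
move=> /nbhs_ballP[e /= e0 eA]; exists (e / 2); first exact: divr_gt0.
move=> z az; apply: eA; split=> // i j; rewrite (ord1 i) /ball /= distrC.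
by apply: le_lt_trans (az j) _; rewrite gtr_pMr// invf_lt1// ltr1n.
Qed.

(** The Euclidean norm is used here, not the sup norm: its square is a polynomial, with Hessian a
    multiple of the identity. *)
Definition paraboloid a r z := r ^+ 2 - \sum_j (z 0 j - a 0 j) ^+ 2.

Definition bump_at a r z := flat 0 (paraboloid a r z).

(** One coordinate at distance more than r already makes [paraboloid] non-positive. *)
Lemma bump_out a r z : 0 <= r -> ~ box a r z -> bump_at a r z = 0.
Proof.
move=> r0 /existsNP[j /negP]; rewrite -ltNge => rz.
apply: flat_le0; rewrite /paraboloid subr_le0 (bigD1 j)//=.
rewrite -[(_ - _) ^+ 2]real_normK ?num_real//.
apply: (@le_trans _ _ (`|z 0 j - a 0 j| ^+ 2)).
  by rewrite ler_pXn2r// ?nnegrE// ltW.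
by rewrite lerDl sumr_ge0// => i _; exact: sqr_ge0.
Qed.

(** [T] is meant to be a transition map. Only sums, products and a one-variable outer function are
    applied to its coordinates, so no chain rule in several variables is involved. *)
Lemma smooth_on_bump a r (A : set 'rV[R]_n) (T : 'rV[R]_n -> 'rV[R]_n) :
  (forall j, smooth_on A (fun x => T x 0 j)) ->
  smooth_on A (fun x => bump_at a r (T x)).
Proof.
move=> TC; apply: (@smooth_on_comp1 _ _ _ (@flat R) (fun m => - m%:R) (fun=> 1)
  (fun x => paraboloid a r (T x)) 0 (@is_derive_flat R)).
have TaC j : smooth_on A (fun x => T x 0 j + cst (- a 0 j) x).
  exact: smooth_onD (TC j) (smooth_on_cst (A := A) _).
have := smooth_onD (smooth_on_cst (A := A) (r ^+ 2))
  (smooth_onM (smooth_on_cst (A := A) (-1))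
    (smooth_on_sum (fun j => smooth_onM (TaC j) (TaC j)))).
by apply: smooth_on_eq => x _; rewrite /= mulN1r.
Qed.

End bump_function.

Section manifold_bump.
Variables (R : realType) (n : nat) (M : manifold R n).
Variables (c : chart_idx M) (a : 'rV[R]_n.+1) (r : R).
Hypotheses (r_ge0 : 0 <= r) (box_img : box a r `<=` img c).

Definition chart_bump (p : M) : R :=
  if `[< dom c p >] then bump_at a r (chart c p) else 0.

Lemma chart_bump_param x : img c x -> chart_bump (param c x) = bump_at a r x.
Proof.
by move=> ix; rewrite /chart_bump asboolT ?paramK//; exact: param_dom.
Qed.

Lemma param_box_closed : closed (param c @` box a r).
Proof.
apply: (compact_closed (@carrier_hausdorff _ _ M)); apply: continuous_compact.
  exact: continuous_subspaceW box_img (param_continuous (c := c)).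
exact: box_compact.
Qed.

Lemma chart_bump_out p : ~ (param c @` box a r) p -> chart_bump p = 0.
Proof.
move=> pK; rewrite /chart_bump; case: asboolP => // cp.
apply: bump_out => // bp.
by apply: pK; exists (chart c p) => //; exact: chartK.
Qed.

(** Two open sets cover M: [dom c], where the bump is composed with a transition map, and the
    complement of the closed image of the box, where it is zero. *)
Lemma chart_bump_smooth : smooth chart_bump.
Proof.
move=> d; apply: smooth_on_local => x ix; have dx := param_dom ix.
have [cx|ncx] := pselect (dom c (param d x)).
  have := near_param dx (open_nbhs_nbhs (conj (dom_open c) cx)).
  rewrite paramK// => nx.
  exists ([set y | img d y -> dom c (param d y)]°); split => //.
    exact: open_interior.
  set A := _ `&` _.
  have := @smooth_on_bump _ _ a r A (fun y => chart c (param d y)).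
  have T j : smooth_on A (fun y => chart c (param d y) 0 j).
    apply: smooth_on_subset (@transition_smooth _ _ M d c j).
    move=> y [iy /interior_subset /= /(_ iy) cy].
    by exists (param d y); [split=> //; exact: param_dom|exact: paramK].
  move=> /(_ T); apply: smooth_on_eq => y [iy /interior_subset /= /(_ iy) cy].
  by rewrite /chart_bump asboolT.
have Ko : open (~` (param c @` box a r)).
  by rewrite openC; exact: param_box_closed.
have := near_param dx (open_nbhs_nbhs (conj Ko _)); rewrite paramK// => nx.
have {}nx : nbhs x [set y | img d y -> ~ (param c @` box a r) (param d y)].
  apply: nx => -[z bz zx]; apply: ncx; rewrite -zx.
  exact/param_dom/box_img.
exists ([set y | img d y -> ~ (param c @` box a r) (param d y)]°); split=> //.
  exact: open_interior.
apply: smooth_on_eq (smooth_on_cst 0).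
by move=> y [iy /interior_subset /= /(_ iy) ny]; rewrite chart_bump_out.
Qed.

End manifold_bump.

Section bump_derivatives.
Variables (R : realType) (n : nat) (a : 'rV[R]_n) (r : R).
Implicit Types (z : 'rV[R]_n) (i j : 'I_n).

Lemma is_derive_paraboloid i z :
  is_derive z (delta_mx 0 i) (paraboloid a r) (- 2 * (z 0 i - a 0 i)).
Proof.
have dl j : is_derive z (delta_mx 0 i) (fun y : 'rV[R]_n => y 0 j + - a 0 j)
    ((i == j)%:R + 0).
  exact: is_derive_addf (derive_coord i j z) (is_derive_cst (- a 0 j) z _).
have ds := is_derive_sumf (fun j => is_derive_mulf (dl j) (dl j)).
have := is_derive_addf (is_derive_cst (r ^+ 2) z _) (is_derive_scalef (-1) ds).
rewrite (_ : (fun _ => _) = paraboloid a r); last first.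
  by apply/funext => y; rewrite /paraboloid mulN1r.
move=> h; apply: is_derive_eq h _.
rewrite add0r (bigD1 i)//= eqxx big1 ?addr0.
  by rewrite !mul1r mulr1; ring.
by move=> j /negPf ji; rewrite eq_sym ji addr0 mul0r mulr0 addr0.
Qed.

Lemma differentiable_paraboloid z : differentiable (paraboloid a r) z.
Proof.
apply: differentiableB => //; apply: differentiable_sumf => j.
have dl : differentiable (fun y : 'rV[R]_n => y 0 j - a 0 j) z.
  by apply: differentiableB => //; exact: differentiable_coord.
exact: differentiableM.
Qed.

(** For m = 0 the [flat 1] term of [is_derive_flat] has coefficient 0, so only [flat 2] remains. *)
Lemma derive_bump i z : 'D_(delta_mx 0 i) (bump_at a r) z =
  flat 2 (paraboloid a r z) * (- 2 * (z 0 i - a 0 i)).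
Proof.
have dq := differentiable_paraboloid z.
rewrite (derive_comp1 _ (is_derive_flat 0 (paraboloid a r z)) dq).
by have [_ ->] := is_derive_paraboloid i z; rewrite oppr0 mul0r add0r mul1r.
Qed.

(** The linear factor of the first derivative vanishes at the centre, so only its own derivative
    survives in the product rule. *)
Lemma derive2_bump_center i j :
  'D_(delta_mx 0 i) (fun y => 'D_(delta_mx 0 j) (bump_at a r) y) a =
  - 2 * flat 2 (r ^+ 2) * (i == j)%:R.
Proof.
have pa : paraboloid a r a = r ^+ 2.
  by rewrite /paraboloid big1 ?subr0// => k _; rewrite subrr expr0n.
under eq_fun do rewrite derive_bump.
have dq := differentiable_paraboloid a.
have df := differentiable_comp1 (is_derive_flat 2 (paraboloid a r a)) dq.
have dl := is_derive_scalef (- 2) (is_derive_addf (derive_coord i j a)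
  (is_derive_cst (- a 0 j) a _)).
have [_ ->] := is_derive_mulf (differentiable_is_derive (delta_mx 0 i) df) dl.
by rewrite pa subrr mulr0 mulr0 add0r addr0; ring.
Qed.

Lemma differentiable_bump_at z : differentiable (bump_at a r) z.
Proof.
have dq := differentiable_paraboloid z.
exact: (differentiable_comp1 (is_derive_flat 0 (paraboloid a r z)) dq).
Qed.

Lemma differentiable_derive_bump_at j z :
  differentiable (fun y => 'D_(delta_mx 0 j) (bump_at a r) y) z.
Proof.
under eq_fun do rewrite derive_bump.
have dq := differentiable_paraboloid z.
apply: differentiableM.
  exact: (differentiable_comp1 (is_derive_flat 2 (paraboloid a r z)) dq).
apply: differentiableM => //; apply: differentiableB => //.
exact: differentiable_coord.
Qed.

End bump_derivatives.

(** * Scalar curvature under a conformal change *)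

Section matrix_differentiable.
Variables (R : realType) (V : normedModType R).
Implicit Type x : V.

Lemma differentiable_prodf (I : Type) (s : seq I) (f : I -> V -> R) x :
  (forall i, differentiable (f i) x) ->
  differentiable (fun y => \prod_(i <- s) f i y) x.
Proof.
move=> fd; elim: s => [|i s IH].
  by under eq_fun do rewrite big_nil; exact: differentiable_cst.
by under eq_fun do rewrite big_cons; exact: differentiableM.
Qed.

Lemma differentiable_det m (A : V -> 'M[R]_m) x :
  (forall i j, differentiable (fun y => A y i j) x) ->
  differentiable (fun y => \det (A y)) x.
Proof.
move=> Ad; rewrite /determinant; apply: differentiable_sumf => s.
apply: differentiableM; first exact: differentiable_cst.
exact: differentiable_prodf.
Qed.

(** Cramer's rule: near x the entry is a cofactor divided by a nonzero determinant, both polynomial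
    in the entries of A. *)
Lemma differentiable_invmx m (A : V -> 'M[R]_m) x i j :
  (forall i j, differentiable (fun y => A y i j) x) ->
  (\forall y \near x, A y \in unitmx) ->
  differentiable (fun y => invmx (A y) i j) x.
Proof.
move=> Ad Au.
pose h y := (\det (A y))^-1 * \adj (A y) i j.
apply: (@near_eq_differentiable _ _ h).
  by apply: filterS Au => y Ay; rewrite /h /invmx Ay [RHS]mxE.
have dx : \det (A x) != 0.
  by rewrite -unitfE -unitmxE; exact: (nbhs_singleton Au).
apply: differentiableM.
  by apply: differentiableV => //; exact: differentiable_det.
under eq_fun do rewrite mxE /cofactor.
apply: differentiableM; first exact: differentiable_cst.
by apply: differentiable_det => k l; under eq_fun do rewrite !mxE.
Qed.

End matrix_differentiable.

(** * Christoffel symbols of e^phi G in coordinates *)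

Section christoffel_conformal.
Variables (R : realType) (n : nat).
Local Notation N := n.+1.
Implicit Types (G : 'rV[R]_N -> 'M[R]_N) (phi : 'rV[R]_N -> R) (x : 'rV[R]_N).
Implicit Types (i j k l m : 'I_N).
Local Notation "''d_' i f" := ('D_(delta_mx 0 i) f)
  (at level 10, i at next level, format "''d_' i  f").

Definition coord_christoffel G k i j x : R :=
  2^-1 * \sum_l invmx (G x) k l *
    ('d_i (fun y => G y j l) x + 'd_j (fun y => G y i l) x
     - 'd_l (fun y => G y i j) x).

Definition cscale phi G : 'rV[R]_N -> 'M[R]_N := fun x => expR (phi x) *: G x.

Lemma derive_cscale phi G i j v x : differentiable phi x ->
  differentiable (fun y => G y i j) x ->
  'D_v (fun y => cscale phi G y i j) x =
  expR (phi x) * ('D_v phi x * G x i j + 'D_v (fun y => G y i j) x).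
Proof.
move=> dphi dG; under eq_fun do rewrite mxE.
have de := is_derive_expR (phi x).
have d1 := differentiable_is_derive v (differentiable_comp1 de dphi).
have [_ ->] := is_derive_mulf d1 (differentiable_is_derive v dG).
by rewrite (derive_comp1 _ de dphi); ring.
Qed.

Lemma invmx_sym (A : 'M[R]_N) : A^T = A -> (invmx A)^T = invmx A.
Proof. by rewrite trmx_inv => ->. Qed.

Lemma invmx_mul_entry (A : 'M[R]_N) i j : A^T = A -> A \in unitmx ->
  \sum_l invmx A i l * A j l = (i == j)%:R.
Proof.
move=> As Au; have := mulVmx Au => /matrixP/(_ i j); rewrite !mxE => <-.
by apply: eq_bigr => l _; rewrite -{2}As mxE.
Qed.

(** The factors e^phi and e^(-phi) cancel. The formula is stated without assuming that x is
    critical, because it has to be differentiated at x. *)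
Lemma coord_christoffel_cscale phi G k i j x :
  (G x)^T = G x -> G x \in unitmx ->
  differentiable phi x -> (forall i j, differentiable (fun y => G y i j) x) ->
  coord_christoffel (cscale phi G) k i j x = coord_christoffel G k i j x +
  2^-1 * ((k == j)%:R * 'd_i phi x + (k == i)%:R * 'd_j phi x
     - (\sum_l invmx (G x) k l * 'd_l phi x) * G x i j).
Proof.
move=> Gs Gu dphi dG; rewrite /coord_christoffel -mulrDr; congr (_ * _).
(* The Kronecker deltas are expanded back into sums over l, so that both sides can be compared term
   by term. *)
rewrite -!(@invmx_mul_entry (G x))// !mulr_suml -sumrN -!big_split/=.
apply: eq_bigr => l _; rewrite !derive_cscale// /cscale.
have e0 : expR (phi x) != 0 by rewrite gt_eqF// expR_gt0.
rewrite invmxZ ?unitmxZ ?unitfE// [in X in X * _]mxE.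
by field.
Qed.

Section second_order.
Variables (U : set 'rV[R]_N) (G : 'rV[R]_N -> 'M[R]_N) (x : 'rV[R]_N).
Hypotheses (Uo : open U) (Ux : U x).
Hypothesis GC : forall i j, is_Ck 2 U (fun y => G y i j).
Hypothesis Gu : forall y, U y -> G y \in unitmx.
Hypothesis Gs : forall y, U y -> (G y)^T = G y.

Let nU : \forall y \near x, U y.
Proof. exact: open_nbhs_nbhs. Qed.

Let dG i j y : U y -> differentiable (fun y => G y i j) y.
Proof. by have [h _] := GC i j; exact: h. Qed.

Let ddG i j k : differentiable (fun y => 'd_k (fun z => G z i j) y) x.
Proof. by have [_ /(_ k) [h _]] := GC i j; exact: h. Qed.

Let dGinv i j : differentiable (fun y => invmx (G y) i j) x.
Proof.
apply: differentiable_invmx => [k l|]; first exact: dG.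
exact: filterS Gu nU.
Qed.

Lemma differentiable_coord_christoffel k i j :
  differentiable (coord_christoffel G k i j) x.
Proof.
apply: differentiableM; first exact: differentiable_cst.
apply: differentiable_sumf => l; apply: differentiableM => //.
apply: differentiableB => //; exact: differentiableD.
Qed.

Variables (phi : 'rV[R]_N -> R) (eta : R).
Hypothesis phiC : is_Ck 2 U phi.
Hypothesis phi_crit : forall i, 'd_i phi x = 0.
Hypothesis phi_hess : forall i j,
  'd_i (fun y => 'd_j phi y) x = eta * (i == j)%:R.

Lemma coord_christoffel_cscale_crit k i j :
  coord_christoffel (cscale phi G) k i j x = coord_christoffel G k i j x.
Proof.
have [dphi _] := phiC.
rewrite coord_christoffel_cscale ?Gs ?Gu//;
  [|exact: dphi|by move=> *; exact: dG].
rewrite !phi_crit !mulr0 add0r big1 ?mul0r ?subrr ?mulr0 ?addr0// => l _.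
by rewrite phi_crit mulr0.
Qed.

Lemma derive_coord_christoffel_cscale m k i j :
  'd_m (coord_christoffel (cscale phi G) k i j) x =
  'd_m (coord_christoffel G k i j) x +
  2^-1 * (eta * ((k == j)%:R * (m == i)%:R + (k == i)%:R * (m == j)%:R
     - invmx (G x) k m * G x i j)).
Proof.
have [dphi ddphi] := phiC.
have hphi l : is_derive x (delta_mx 0 m) (fun y => 'd_l phi y)
    (eta * (m == l)%:R).
  rewrite -phi_hess; apply: differentiable_is_derive.
  by have [h _] := ddphi l; exact: h.
pose T y := 2^-1 * ((k == j)%:R * 'd_i phi y + (k == i)%:R * 'd_j phi y
     + (-1) * ((\sum_l invmx (G y) k l * 'd_l phi y) * G y i j)).
rewrite (@near_eq_derive _ _ _ _
  (fun y => coord_christoffel G k i j y + T y)); last first.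
  apply: filterS nU => y Uy.
  rewrite coord_christoffel_cscale ?Gs ?Gu//;
    [by rewrite /T mulN1r|exact: dphi|].
  by move=> *; exact: dG.
have dT := is_derive_scalef 2^-1 (is_derive_addf
  (is_derive_addf (is_derive_scalef (k == j)%:R (hphi i))
                  (is_derive_scalef (k == i)%:R (hphi j)))
  (is_derive_scalef (-1) (is_derive_mulf
    (is_derive_sumf (fun l => is_derive_mulf
       (differentiable_is_derive (delta_mx 0 m) (dGinv k l)) (hphi l)))
    (differentiable_is_derive (delta_mx 0 m) (dG i j Ux))))).
have [_ ->] := is_derive_addf (differentiable_is_derive (delta_mx 0 m)
  (differentiable_coord_christoffel k i j)) dT.
congr (_ + _ * _).
(* Derivatives of [G] and of its inverse come multiplied by first derivatives of phi, which vanish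
   at x; of the sum over l the Hessian keeps l = m. *)
under [X in X * G x i j]eq_bigr do rewrite phi_crit mulr0 add0r.
rewrite (bigD1 m)//= big1 ?addr0; last first.
  by move=> l /negPf lm; rewrite eq_sym lm !mulr0.
rewrite big1 ?mul0r ?addr0; last by move=> l _; rewrite phi_crit mulr0.
by rewrite eqxx mulr1; ring.
Qed.

End second_order.
End christoffel_conformal.

(** * Curvature at a critical point of phi with Hessian eta * Id *)

Section scalar_curvature_conformal.
Variables (R : realType) (n : nat) (M : manifold R n).
Local Notation N := n.+1.
Implicit Types (g : riemannian_metric M) (i j k l m : 'I_N).
Local Notation "''d_' i f" := ('D_(delta_mx 0 i) f)
  (at level 10, i at next level, format "''d_' i  f").

Lemma sum_eqr (A : pzSemiRingType) j (F : 'I_N -> A) :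
  \sum_i (i == j)%:R * F i = F j.
Proof.
rewrite (bigD1 j)//= eqxx mul1r big1 ?addr0// => i /negPf ->.
by rewrite mul0r.
Qed.

Lemma sum_eql (A : pzSemiRingType) j (F : 'I_N -> A) :
  \sum_i (j == i)%:R * F i = F j.
Proof. by rewrite -[RHS]sum_eqr; apply: eq_bigr => i _; rewrite eq_sym. Qed.

Variable c : chart_idx M.

Definition coord_metric g : 'rV[R]_N -> 'M[R]_N := fun x => g c (param c x).

Lemma christoffel_param g k i j y : nbhs y (img c) ->
  christoffel g c k i j (param c y) =
  coord_christoffel (coord_metric g) k i j y.
Proof.
move=> ny; have iy := nbhs_singleton ny.
rewrite /christoffel /coord_christoffel.
by congr (_ * _); apply: eq_bigr => l _; rewrite !pderivE paramK.
Qed.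

Variable p : M.
Hypotheses (cp : dom c p) (nx : nbhs (chart c p) (img c)).

Lemma pderiv_christoffel g m k i j :
  pderiv c m (christoffel g c k i j) p =
  'd_m (coord_christoffel (coord_metric g) k i j) (chart c p).
Proof.
rewrite (pderivE _ _ nx); apply: near_eq_derive.
have ni : nbhs (chart c p) (img c)° := nbhs_interior nx.
by apply: filterS ni => y ny; exact: christoffel_param.
Qed.

Variables (g : riemannian_metric M) (phi : M -> R) (phi_smooth : smooth phi).
Variable eta : R.
Let x := chart c p.
Let phihat y := phi (param c y).
Hypothesis phi_crit : forall i, 'd_i phihat x = 0.
Hypothesis phi_hess : forall i j,
  'd_i (fun y => 'd_j phihat y) x = eta * (i == j)%:R.

Local Notation g' := (conformal_metric g phi_smooth).
Let U := (img c)°.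
Let G := coord_metric g.

Let Uo : open U. Proof. exact: open_interior. Qed.
Let Ux : U x. Proof. exact: nx. Qed.
Let GC i j : is_Ck 2 U (fun y => G y i j).
Proof.
exact: smooth_on_Cinfty Uo (@interior_subset _ _)
  (@metric_smooth _ _ _ g c i j) _.
Qed.
Let phiC : is_Ck 2 U phihat.
Proof. exact: smooth_on_Cinfty Uo (@interior_subset _ _) (@phi_smooth c) _. Qed.
Let Gu y : U y -> G y \in unitmx.
Proof. by move=> /interior_subset/param_dom; exact: metric_unitmx. Qed.
Let Gs y : U y -> (G y)^T = G y.
Proof. by move=> /interior_subset/param_dom; exact: Defs.metric_sym. Qed.
Let Gx : G x = g c p. Proof. by rewrite /G /coord_metric chartK. Qed.
Let H : 'M[R]_N := invmx (g c p).

Lemma christoffel_crit k i j :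
  christoffel g' c k i j p = christoffel g c k i j p.
Proof.
rewrite -(chartK cp) !christoffel_param//.
exact: (coord_christoffel_cscale_crit Ux GC Gu Gs phiC phi_crit).
Qed.

Lemma pderiv_christoffel_crit m k i j :
  pderiv c m (christoffel g' c k i j) p =
  pderiv c m (christoffel g c k i j) p +
  2^-1 * (eta * ((k == j)%:R * (m == i)%:R + (k == i)%:R * (m == j)%:R
    - H k m * g c p i j)).
Proof.
rewrite !pderiv_christoffel.
by rewrite (derive_coord_christoffel_cscale Uo Ux GC Gu Gs phiC phi_crit
  phi_hess) Gx.
Qed.

(** The quadratic terms do not change. In the derivative terms, the part [(l == k)%:R * (i == j)%:R]
    is symmetric in i and j and cancels. *)
Lemma riemann_crit i j k l : riemann g' c i j k l p = riemann g c i j k l p +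
  2^-1 * eta * ((l == j)%:R * (i == k)%:R - (l == i)%:R * (j == k)%:R
    - H l i * g c p j k + H l j * g c p i k).
Proof.
rewrite /riemann !pderiv_christoffel_crit.
under eq_bigr do rewrite !christoffel_crit.
by rewrite (eq_sym j i); ring.
Qed.

Let Hs i j : H i j = H j i.
Proof.
by rewrite /H -{1}(invmx_sym (Defs.metric_sym g cp)) mxE.
Qed.

Let gs i j : g c p i j = g c p j i.
Proof. by rewrite -{1}(Defs.metric_sym g cp) mxE. Qed.

Let HG i j : \sum_l H i l * g c p j l = (i == j)%:R.
Proof.
by apply: invmx_mul_entry; [exact: Defs.metric_sym|exact: metric_unitmx].
Qed.

Lemma ricci_crit j k : ricci g' c j k p = ricci g c j k p +
  2^-1 * eta * ((2 - N%:R) * (j == k)%:R - \tr H * g c p j k).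
Proof.
rewrite /ricci; under eq_bigr do rewrite riemann_crit.
rewrite big_split/= -mulr_sumr; congr (_ + _ * _).
rewrite big_split/= !sumrB sum_eqr.
have -> : \sum_(i < N) (i == i)%:R * (j == k)%:R = N%:R * (j == k)%:R :> R.
  under eq_bigr do rewrite eqxx mul1r.
  by rewrite sumr_const card_ord mulr_natl.
rewrite -mulr_suml -/(\tr H).
have -> : \sum_i H i j * g c p i k = (j == k)%:R.
  by rewrite -HG; apply: eq_bigr => i _; rewrite Hs gs.
by ring.
Qed.

Lemma scalar_curvature_crit : scalar_curvature_in g' c p =
  expR (- phi p) * (scalar_curvature_in g c p - n%:R * eta * \tr H).
Proof.
rewrite /scalar_curvature_in.
have HE j k : invmx (g' c p) j k = expR (- phi p) * H j k.
  rewrite /= invmxZ ?unitmxZ ?unitfE ?gt_eqF ?expR_gt0//; last first.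
    exact: metric_unitmx.
  by rewrite mxE expRN.
under eq_bigr => j _ do
  under eq_bigr => k _ do rewrite HE -mulrA ricci_crit mulrDr.
under eq_bigr => j _ do rewrite -mulr_sumr big_split/=.
rewrite -mulr_sumr big_split/=; congr (_ * (_ + _)).
(* Summed over j, these rows give (2 - N) tr H - N tr H = - 2 n tr H, since N = n + 1; the factor
   1/2 then leaves - n eta tr H. *)
have row j : \sum_k H j k *
    (2^-1 * eta * ((2 - N%:R) * (j == k)%:R - \tr H * g c p j k)) =
    2^-1 * eta * ((2 - N%:R) * H j j - \tr H).
  transitivity (2^-1 * eta * ((2 - N%:R) * \sum_k (j == k)%:R * H j k
      - \tr H * \sum_k H j k * g c p j k)).
    by rewrite mulrBr !mulr_sumr -sumrB; apply: eq_bigr => k _; ring.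
  by rewrite sum_eql HG eqxx mulr1.
under eq_bigr => j _ do rewrite row.
rewrite -mulr_sumr sumrB -mulr_sumr -/(\tr H) sumr_const card_ord.
by rewrite -[_ *+ N]mulr_natr -natr1; field.
Qed.

(** Each diagonal entry H i i is the value of the quadratic form of g on the i-th row of H. *)
Lemma trace_invmx_gt0 : 0 < \tr H.
Proof.
have gu := metric_unitmx g cp.
have H0 i : 0 < H i i.
  have v0 : row i H != 0.
    apply/eqP => /(congr1 (mulmx^~ (g c p))).
    rewrite -row_mul mulVmx// mul0mx => /matrixP/(_ 0 i).
    by rewrite !mxE eqxx => /eqP; rewrite oner_eq0.
  have := metric_posdef g cp v0.
  rewrite -row_mul mulVmx// tr_row (invmx_sym (Defs.metric_sym g cp)).
  by rewrite -row_mul mul1mx !mxE.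
rewrite /mxtrace (bigD1 ord0)//= ltr_wpDr// sumr_ge0// => i _; exact: ltW.
Qed.

End scalar_curvature_conformal.

Theorem corollary5p3 (R : realType) (n : nat) (n_ge3 : (3 <= n.+1)%N)
    (M : manifold R n) (M_nonempty : [set: M] !=set0)
    (M_compact : compact [set: M]) (g : riemannian_metric M)
    (S_le0 : forall p : M, scalar_curvature g p <= 0) :
  exists g' : riemannian_metric M,
    [/\ conformal g g',
        (exists p : M, 0 < scalar_curvature g' p) &
        (forall p : M, boundary M p ->
          Num.sg (mean_curvature g p) = Num.sg (mean_curvature g' p))].
Proof.
have [p0 p0_int] := exists_interior_point g M_nonempty.
set c := chart_at p0; have cp0 : dom c p0 := dom_chart_at p0.
set a := chart c p0.
have [r r0 rbox] := nbhs_box (nbhs_img (chart_img cp0) p0_int).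
have box_img : box a r `<=` img c by move=> z /rbox[].
have nx : nbhs (chart c p0) (img c).
  by apply: filterS (nbhs_img (chart_img cp0) p0_int) => z [].
pose psi := chart_bump c a r.
have psiC : smooth psi := chart_bump_smooth (ltW r0) box_img.
have scaleC t : smooth (fun p => t * psi p).
  by move=> d; exact: smooth_onM (smooth_on_cst t) (psiC d).
have tr_gt0 := trace_invmx_gt0 cp0 g.
set T := \tr _ in tr_gt0.
have kappa_gt0 : 0 < flat 2 (r ^+ 2) by rewrite flat_gt0// exprn_gt0.
set kappa := flat 2 _ in kappa_gt0.
have n_gt1 : 1 < n%:R :> R by rewrite ltr1n.
have n_gt0 : 0 < n%:R :> R := lt_trans ltr01 n_gt1.
(* The Hessian of tau * psi at the centre is eta * Id with eta = - 2 tau kappa; this tau solves S -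
   n eta T = 1. *)
pose tau := (1 - scalar_curvature g p0) / (2 * n%:R * kappa * T).
pose g' := conformal_metric g (scaleC tau).
exists g'; split.
(* The dimension is n + 1, so the exponent of u is 4 / (n - 1), and u = e^(phi (n - 1) / 4). *)
- have n1 : n%:R - 1 != 0 :> R by rewrite subr_eq0 gt_eqF.
  have e_neq0 : critical_exponent R n.+1 - 2 != 0.
    rewrite /critical_exponent -natr1.
    rewrite (_ : _ - 2 = 4 / (n%:R - 1)); last by field.
    by rewrite mulf_neq0 ?invr_neq0// pnatr_eq0.
  exists (fun p => expR (tau / (critical_exponent R n.+1 - 2) * psi p)).
  split=> [d|p|d p dp]; [|exact: expR_gt0|].
    exact: smooth_on_expR (@scaleC _ d).
  rewrite /g' /= -expRM; congr (expR _ *: _).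
  by rewrite [RHS]mulrAC divfK.
- exists p0; rewrite /scalar_curvature -/c.
  have psiE (y : 'rV[R]_n.+1) : nbhs y (img c) ->
     \forall z \near y, tau * psi (param c z) = tau * bump_at a r z.
    by move=> ny; apply: filterS (ny) => z iz; rewrite /psi chart_bump_param.
  have dphi i (y : 'rV[R]_n.+1) : nbhs y (img c) ->
     'D_(delta_mx 0 i) (fun z => tau * psi (param c z)) y =
     tau * 'D_(delta_mx 0 i) (bump_at a r) y.
    move=> ny; rewrite (near_eq_derive _ (psiE _ ny)).
    have := is_derive_scalef tau
      (differentiable_is_derive (delta_mx 0 i) (differentiable_bump_at a r y)).
    by case.
  rewrite (@scalar_curvature_crit _ _ _ _ _ cp0 nx g _ _ (- 2 * tau * kappa)).
  + rewrite mulr_gt0 ?expR_gt0// -/T.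
    have -> : n%:R * (- 2 * tau * kappa) * T = scalar_curvature g p0 - 1.
      by rewrite /tau; field; rewrite !gt_eqF.
    by rewrite opprB addrC subrK ltr01.
  + by move=> i; rewrite dphi// derive_bump subrr !mulr0.
  + move=> i j.
    rewrite (near_eq_derive _
      (g := fun y => tau * 'D_(delta_mx 0 j) (bump_at a r) y)); last first.
      have ni : nbhs a (img c)° := nbhs_interior nx.
      by apply: filterS ni => y; exact: dphi.
    have := is_derive_scalef tau (differentiable_is_derive (delta_mx 0 i)
      (differentiable_derive_bump_at a r j a)).
    by case=> _ ->; rewrite derive2_bump_center -/kappa; ring.
- move=> p pb; congr (Num.sg _); apply: near_mean_curvature => d.
  have Ko : open (~` (param c @` box a r)).
    by rewrite openC; exact: param_box_closed.
  (* If p were in the image of the box, [boundary_chart] would put it on the wall for [c], whereas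
     [rbox] keeps the box in x^0 > 0. *)
  have pK : ~ (param c @` box a r) p.
    move=> [z bz zp]; have [iz /=] := rbox z bz.
    have := boundary_chart g (param_dom iz); rewrite zp => /(_ pb).
    by rewrite -zp paramK// => ->; rewrite ltxx.
  apply: filterS (open_nbhs_nbhs (conj Ko pK)) => q qK.
  by rewrite /g' /= /psi (chart_bump_out (ltW r0) qK) mulr0 expR0 scale1r.
Qed.
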